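(* Let $(A,\cdot_A,P,Q)$ be an admissible averaging commutative algebra. Let $\triangleright_A,\triangleleft_A:A\otimes A\to A$ be the multiplications defined by $$x\triangleright_A y=P(x)\cdot_A y+Q(x\cdot_A y),\qquad x\triangleleft_A y=-Q(x\cdot_A y),\qquad\forall x,y\in A.$$ Then $(A,\triangleright_A,\triangleleft_A)$ is a special apre-perm algebra.
   Context: All vector spaces and algebras are finite-dimensional over an algebraically closed field $\mathbb K$ of characteristic zero; ''commutative algebra'' means commutative associative algebra. An admissible averaging commutative algebra $(A,\cdot_A,P,Q)$ is a commutative algebra $(A,\cdot_A)$ with linear maps $P,Q:A\to A$ such that for all $x,y\in A$: $P(x)\cdot_A P(y)=P(P(x)\cdot_A y)$ and $P(x)\cdot_A Q(y)=Q(P(x)\cdot_A y)=Q(x\cdot_A Q(y))$. A perm algebra $(A,\circ_A)$ is a vector space with a bilinear operation satisfying $x\circ_A(y\circ_A z)=(x\circ_A y)\circ_A z=(y\circ_A x)\circ_A z$ for all $x,y,z$. An apre-perm algebra is a vector space $A$ with multiplications $\triangleright_A,\triangleleft_A:A\otimes A\to A$ such that, setting $x\circ_A y=x\triangleright_A y+x\triangleleft_A y$ and $x\bullet_A y=x\triangleright_A y+y\triangleleft_A x$, $(A,\circ_A)$ is a perm algebra and for all $x,y,z\in A$: $(x\circ_A y)\bullet_A z=x\bullet_A(y\bullet_A z)=y\bullet_A(x\bullet_A z)$ and $z\triangleleft_A(x\circ_A y)=-(z\triangleleft_A y)\triangleleft_A x=x\bullet_A(z\triangleleft_A y)=(x\bullet_A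 z)\triangleleft_A y$. It is called special if $\triangleleft_A$ is commutative. *)

(* Defs.v *)
From mathcomp Require Import all_boot all_order all_algebra.

Set Implicit Arguments.
Unset Strict Implicit.
Unset Printing Implicit Defensive.

Import GRing.Theory.
Local Open Scope ring_scope.

(* Algebras here need not be unital and a single vector space carries several
   products, so a product is a bilinear binary operation on a [vectType]
   rather than an instance of MathComp's (unital) ring structures. *)

Section Algebras.

Variables (K : fieldType) (A : vectType K).
Implicit Types (mul circ tr tl : A -> A -> A) (P Q : {linear A -> A}).

Definition is_product mul : Prop :=
  (forall y, linear (fun x => mul x y)) /\ (forall x, linear (mul x)).

Definition comm_algebra mul : Prop :=
  [/\ is_product mul, commutative mul & associative mul].

Definition admissible_averaging_comm_algebra mul P Q : Prop :=
  [/\ comm_algebra mul,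
      forall x y, mul (P x) (P y) = P (mul (P x) y)
    & forall x y, mul (P x) (Q y) = Q (mul (P x) y)
               /\ Q (mul (P x) y) = Q (mul x (Q y))].

Definition perm_algebra circ : Prop :=
  is_product circ /\
  forall x y z, circ x (circ y z) = circ (circ x y) z
             /\ circ (circ x y) z = circ (circ y x) z.

(* The operations \circ and \bullet induced by (\triangleright, \triangleleft);
   note that \bullet swaps the arguments of \triangleleft. *)
Definition circ_of tr tl (x y : A) : A := tr x y + tl x y.
Definition bullet_of tr tl (x y : A) : A := tr x y + tl y x.

Definition apre_perm_algebra tr tl : Prop :=
  let circ := circ_of tr tl in
  let bullet := bullet_of tr tl in
  [/\ is_product tr,
      is_product tl,
      perm_algebra circ,
      forall x y z, bullet (circ x y) z = bullet x (bullet y z)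
                 /\ bullet x (bullet y z) = bullet y (bullet x z)
    & forall x y z, [/\ tl z (circ x y) = - tl (tl z y) x,
                        - tl (tl z y) x = bullet x (tl z y)
                      & bullet x (tl z y) = tl (bullet x z) y]].

Definition special_apre_perm_algebra tr tl : Prop :=
  apre_perm_algebra tr tl /\ commutative tl.

End Algebras.

(* Main.v *)
Require Import Defs.
From mathcomp Require Import all_boot all_order all_algebra.

(** Write [x y] for [mul x y]. In both [circ] and [bullet] the terms [Q(x y)]
    cancel (for [bullet], because the product is commutative), so the two
    operations coincide with [P(x) y], the perm product of an averaging
    operator ([averaging_circ], [averaging_bullet]). The perm identities and the
    first family of apre-perm identities then all say that [P(P(x) y) z] and
    [P(x) (P(y) z)] are the same element, symmetric in [x] and [y]
    ([averaging_actM], [averaging_actC]). In the second family, all four terms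
    equal [- Q(P(x) (z y))]: admissibility moves the factor [P(x)] through [Q],
    and replaces [x Q(z y)] by [P(x) (z y)] under [Q]. *)

Import GRing.Theory.
Local Open Scope ring_scope.

Section BilinearProducts.

Context {K : fieldType} {A : vectType K}.

Lemma is_productD (f g : A -> A -> A) :
  is_product f -> is_product g -> is_product (fun x y => f x y + g x y).
Proof.
move=> [fl fr] [gl gr].
by split=> [y a u v|x a u v]; rewrite ?fl ?gl ?fr ?gr scalerDr addrACA.
Qed.

Lemma is_product_postcomp (f : A -> A -> A) (L : {linear A -> A}) :
  is_product f -> is_product (fun x y => L (f x y)).
Proof.
by move=> [fl fr]; split=> [y a u v|x a u v]; rewrite ?fl ?fr linearP.
Qed.

Lemma is_productN (f : A -> A -> A) :
  is_product f -> is_product (fun x y => - f x y).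
Proof.
by move=> [fl fr]; split=> [y a u v|x a u v]; rewrite ?fl ?fr opprD scalerN.
Qed.

Lemma is_product_precompl (f : A -> A -> A) (L : {linear A -> A}) :
  is_product f -> is_product (fun x y => f (L x) y).
Proof.
by move=> [fl fr]; split=> [y a u v|x a u v]; rewrite ?linearP ?fl ?fr.
Qed.

Lemma is_product_mulrN (f : A -> A -> A) :
  is_product f -> forall x y, f x (- y) = - f x y.
Proof.
move=> [_ fr] x y.
have fx0 : f x 0 = 0.
  by have := fr x (-1) 0 0; rewrite scaler0 addr0 scaleN1r addNr.
by have := fr x (-1) y 0; rewrite fx0 !addr0 !scaleN1r.
Qed.

Lemma eq_is_product (f g : A -> A -> A) :
  (forall x y, f x y = g x y) -> is_product f -> is_product g.
Proof.
by move=> fg [fl fr]; split=> [y a u v|x a u v]; rewrite -!fg ?fl ?fr.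
Qed.

End BilinearProducts.

Section Averaging.

Context {K : fieldType} {A : vectType K}.
Variables (mul : A -> A -> A) (P Q : {linear A -> A}).

Let tr x y := mul (P x) y + Q (mul x y).
Let tl x y := - Q (mul x y).

Lemma averaging_circ x y : circ_of tr tl x y = mul (P x) y.
Proof. by rewrite /circ_of /tr /tl addrK. Qed.

Hypothesis mulC : commutative mul.

Lemma averaging_bullet x y : bullet_of tr tl x y = mul (P x) y.
Proof. by rewrite /bullet_of /tr /tl (mulC y) addrK. Qed.

Hypothesis mulA : associative mul.
Hypothesis PM : forall x y, mul (P x) (P y) = P (mul (P x) y).

(** The averaging identity makes [x |-> mul (P x)] turn the perm product into
    composition of operators; these operators commute since [mul] does. *)
Lemma averaging_actM x y z : mul (P (mul (P x) y)) z = mul (P x) (mul (P y) z).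
Proof. by rewrite -PM mulA. Qed.

Lemma averaging_actC x y z : mul (P x) (mul (P y) z) = mul (P y) (mul (P x) z).
Proof. by rewrite mulA (mulC (P x)) -mulA. Qed.

End Averaging.

Theorem proposition3p22 (K : closedFieldType) (charK0 : [pchar K] =i pred0)
    (A : vectType K) (mul : A -> A -> A) (P Q : {linear A -> A}) :
  admissible_averaging_comm_algebra mul P Q ->
  special_apre_perm_algebra
    (fun x y : A => mul (P x) y + Q (mul x y))
    (fun x y : A => - Q (mul x y)).
Proof.
move=> [[mulP mulC mulA] PM QM].
have circE := @averaging_circ K A mul P Q.
have bulletE := @averaging_bullet K A mul P Q mulC.
have actM := @averaging_actM K A mul P mulA PM.
have actC := @averaging_actC K A mul P mulC mulA.
have mulN := is_product_mulrN _ mulP.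
have PmulP : is_product (fun x y => mul (P x) y) by apply: is_product_precompl.
have QmulP : is_product (fun x y => Q (mul x y)) by apply: is_product_postcomp.
split; last by move=> x y; rewrite mulC.
split.
- exact: is_productD.
- exact: is_productN.
- split; first by apply: eq_is_product PmulP => x y; rewrite circE.
  by move=> x y z; rewrite !circE !actM; split; last exact: actC.
- by move=> x y z; rewrite circE !bulletE actM; split; last exact: actC.
- move=> x y z; rewrite circE !bulletE mulN.
  have [PQ QQ] := QM x (mul z y).
  split.
  + by rewrite mulC -mulA (mulC y) QQ [in RHS]mulC mulN (linearN Q) opprK.
  + by rewrite [in LHS]mulC mulN (linearN Q) opprK -QQ PQ.
  + by rewrite PQ mulA.
Qed.
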